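(* The identity problem between arithmetic terms is algorithmically undecidable: there is no algorithm which, given two univariate arithmetic terms $t_1(n)$ and $t_2(n)$, decides whether $$\forall\, n \in \mathbb{N}\quad t_1(n) = t_2(n).$$
   Context: $\mathbb{N}=\{0,1,2,\dots\}$. An arithmetic term is a finite expression built from variables ranging over $\mathbb{N}$ and natural-number constants by composing the operations addition $x+y$, truncated subtraction $x \dot{-} y=\max(x-y,0)$, multiplication $xy$, integer division $\lfloor x/y\rfloor$, remainder $x \bmod y$, and exponentiation $x^y$. Conventions: $x \bmod 0 = x$, and, for definiteness, $\lfloor x/0\rfloor=0$ and $0^0=1$. *)

(* Defs.v *)
From mathcomp Require Import all_boot.

Set Implicit Arguments.
Unset Strict Implicit.
Unset Printing Implicit Defensive.

Inductive aterm (V : Type) : Type :=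
| Var of V
| Const of nat
| Add of aterm V & aterm V
| Sub of aterm V & aterm V
| Mul of aterm V & aterm V
| Div of aterm V & aterm V
| Mod of aterm V & aterm V
| Exp of aterm V & aterm V.

(* The boundary conventions are those of ssrnat and div: truncated [subn],    *)
(* [x %/ 0 = 0], [x %% 0 = x] and [0 ^ 0 = 1].                                *)
Fixpoint eval (V : Type) (rho : V -> nat) (t : aterm V) : nat :=
  match t with
  | Var v => rho v
  | Const c => c
  | Add a b => eval rho a + eval rho b
  | Sub a b => eval rho a - eval rho b
  | Mul a b => eval rho a * eval rho b
  | Div a b => eval rho a %/ eval rho b
  | Mod a b => eval rho a %% eval rho b
  | Exp a b => eval rho a ^ eval rho b
  end.

Definition uterm : Type := aterm unit.

Definition ueval (t : uterm) (n : nat) : nat := eval (fun _ : unit => n) t.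

(* Cantor's pairing: 'C((x + y).+1, 2) is the triangular number               *)
(* (x + y)(x + y + 1) / 2.                                                    *)
Definition cpair (x y : nat) : nat := 'C((x + y).+1, 2) + y.

(* Algorithms receive terms through this Goedel numbering.                    *)
Fixpoint godel (t : uterm) : nat :=
  match t with
  | Var _ => cpair 0 0
  | Const c => cpair 1 c
  | Add a b => cpair 2 (cpair (godel a) (godel b))
  | Sub a b => cpair 3 (cpair (godel a) (godel b))
  | Mul a b => cpair 4 (cpair (godel a) (godel b))
  | Div a b => cpair 5 (cpair (godel a) (godel b))
  | Mod a b => cpair 6 (cpair (godel a) (godel b))
  | Exp a b => cpair 7 (cpair (godel a) (godel b))
  end.

Lemma cpair_inj (x y x' y' : nat) :
  cpair x y = cpair x' y' -> x = x' /\ y = y'.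
Proof.
have lt_cpair a b a' b' : a + b < a' + b' -> cpair a b < cpair a' b'.
  move=> lt_s; rewrite /cpair; apply: (@leq_trans 'C((a + b).+2, 2)).
    by rewrite [in ltnRHS]binS bin1 ltn_add2l ltnS leq_addl.
  by apply: leq_trans (leq_addr _ _); apply: leq_bin2l.
move=> eq_c; have eq_s : x + y = x' + y'.
  by case: (ltngtP (x + y) (x' + y')) => // /lt_cpair; rewrite eq_c ltnn.
move: eq_c; rewrite /cpair eq_s => /addnI eq_y; split=> //.
by move: eq_s; rewrite eq_y => /addIn.
Qed.

Lemma godel_inj : injective godel.
Proof.
elim=> [[]|c|a IHa b IHb|a IHa b IHb|a IHa b IHb|a IHa b IHb|a IHa b IHb
       |a IHa b IHb]; case=> [[]|c'|a' b'|a' b'|a' b'|a' b'|a' b'|a' b'] //=;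
  move=> /cpair_inj[] //.
- by move=> _ ->.
all: by move=> _ /cpair_inj[/IHa -> /IHb ->].
Qed.

(* Minsky register machines, the model of computation.  Every instruction     *)
(* names its successors: [Inc r q] increments register r and goes to q;       *)
(* [Dec r q q0] decrements register r and goes to q if r is nonzero, and goes *)
(* to q0 otherwise.                                                           *)
Inductive instr : Type :=
| Inc (r q : nat)
| Dec (r q q0 : nat).

Definition program : Type := seq instr.

Definition config : Type := (nat * (nat -> nat))%type.

Definition upd (R : nat -> nat) (r v : nat) : nat -> nat :=
  fun i => if i == r then v else R i.

(* The machine halts when its program counter leaves the program; such        *)
(* configurations are fixed points of [step].                                 *)
Definition step (P : program) (c : config) : config :=
  let: (pc, R) := c in
  match onth P pc with
  | Some (Inc r q) => (q, upd R r (R r).+1)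
  | Some (Dec r q q0) =>
      if R r is n.+1 then (q, upd R r n) else (q0, R)
  | None => c
  end.

Definition start (input : seq nat) : config := (0, nth 0 input).

(* The output is read in register 0.                                          *)
Definition outputs (P : program) (input : seq nat) (y : nat) : Prop :=
  exists k : nat,
    let c := iter k (step P) (start input) in size P <= c.1 /\ c.2 0 = y.

(* P is an algorithm for the binary problem Q on terms: it halts on every     *)
(* instance, with the answer 1 or 0.                                          *)
Definition decides (P : program) (Q : uterm -> uterm -> Prop) : Prop :=
  forall t1 t2 : uterm,
    (Q t1 t2 -> outputs P [:: godel t1; godel t2] 1) /\
    (~ Q t1 t2 -> outputs P [:: godel t1; godel t2] 0).

(* Main.v *)
Require Import Defs.
From mathcomp Require Import all_boot.
From mathcomp Require Import zify.

Set Implicit Arguments.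
Unset Strict Implicit.
Unset Printing Implicit Defensive.

(* A run of a register machine is coded by the numbers whose base-[Q] digits  *)
(* are the contents of each register and the indicators of each transition    *)
(* over time; validity is then a conjunction of linear equations and of       *)
(* bitwise inclusions, expressed as the oddness of a binomial coefficient     *)
(* (Jones-Matiyasevich), all of which are arithmetic terms.  The unknowns are *)
(* read off a single variable [n] by a term for the integer square root.      *)
(*   If [P] decided identity, consider t(n) := [z(n) = c] * B(n), where z is  *)
(* a component of n, B(n) says that n codes a run of [P] answering 1 on the   *)
(* codes of t and of the zero term, and c := godel B.  This is not circular:  *)
(* godel t is an arithmetic term in c, so B can compute it from z(n).  Now    *)
(* [P] answers that t is identically 0 iff t(n) = 1 for some n.               *)

(** * Positional notation and bitwise inclusion *)

(** For a fixed [P], the term [historyT] tests whether [w] codes a run of [P] on [x1], [x2] that has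
    halted by time [s] with answer 1. By Lucas' theorem modulo 2, the parity of a binomial
    coefficient expresses bitwise inclusion, digit by digit in a base [2 ^ e] ([odd_bin_num]), and
    this parity is computed by exponentiation and division ([odd_bin_div]). So an answer 1 amounts
    to solvability in the two unknowns [s], [w] ([history_run], [outputs1E]). A diagonal argument
    takes the place of a universal machine: the guarded term of [corollary1] takes the value 1
    somewhere if [P] declares it identically zero, and is identically zero otherwise. *)

Definition num (Q T : nat) (f : nat -> nat) : nat := \sum_(t < T) f t * Q ^ t.

Lemma num_recl Q T f : num Q T.+1 f = f 0 + Q * num Q T (fun t => f t.+1).
Proof.
rewrite /num big_ord_recl muln1 big_distrr /=; congr addn.
by apply: eq_bigr => i _; rewrite /bump add1n expnS mulnCA.
Qed.

Lemma num_recr Q T f : num Q T.+1 f = num Q T f + f T * Q ^ T.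
Proof. by rewrite /num big_ord_recr. Qed.

Lemma eq_num Q T f g : (forall t, t < T -> f t = g t) -> num Q T f = num Q T g.
Proof. by move=> fg; apply: eq_bigr => i _; rewrite fg. Qed.

Lemma numD Q T f g : num Q T f + num Q T g = num Q T (fun t => f t + g t).
Proof. by rewrite -big_split; apply: eq_bigr => i _; rewrite mulnDl. Qed.

Lemma numZ Q T a f : a * num Q T f = num Q T (fun t => a * f t).
Proof. by rewrite /num big_distrr /=; apply: eq_bigr => i _; rewrite mulnA. Qed.

Lemma num_sum Q T K (a : nat -> nat) (d : nat -> nat -> nat) :
  \sum_(k < K) a k * num Q T (d k) =
  num Q T (fun t => \sum_(k < K) a k * d k t).
Proof.
under eq_bigr => k _ do rewrite numZ.
rewrite exchange_big; apply: eq_bigr => t _.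
by rewrite big_distrl.
Qed.

Lemma num_lt Q T f : (forall t, t < T -> f t < Q) -> num Q T f < Q ^ T.
Proof.
elim: T => [|T IH] fQ; first by rewrite /num big_ord0.
rewrite num_recr expnS.
have /IH lt1: forall t, t < T -> f t < Q by move=> t tT; apply: fQ; lia.
have := fQ T (ltnSn T); nia.
Qed.

Lemma num_inj Q T f g :
    (forall t, t < T -> f t < Q) -> (forall t, t < T -> g t < Q) ->
  num Q T f = num Q T g -> forall t, t < T -> f t = g t.
Proof.
elim: T f g => [|T IH] f g fQ gQ // /[!num_recl] eq_fg.
have f0 := fQ 0 isT; have g0 := gQ 0 isT.
have eq0 : f 0 = g 0.
  have := congr1 (modn^~ Q) eq_fg.
  by rewrite /= ![_ + Q * _]addnC ![Q * _]mulnC !modnMDl !modn_small.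
case=> [|t] // tT; apply: (IH (fun t => f t.+1) (fun t => g t.+1)) => //.
- by move=> u uT; apply: fQ.
- by move=> u uT; apply: gQ.
- move: eq_fg; rewrite eq0 => /addnI/eqP.
  by rewrite eqn_pmul2l ?(leq_trans _ f0) // => /eqP.
Qed.

Lemma num_divX Q s f :
  (forall t, t <= s -> f t < Q) -> num Q s.+1 f %/ Q ^ s = f s.
Proof.
move=> fQ; have Q0 : 0 < Q by have := fQ 0 isT; lia.
rewrite num_recr addnC divnMDl ?expn_gt0 ?Q0 // divn_small ?addn0 //.
by apply: num_lt => t ts; apply: fQ; apply: ltnW.
Qed.

Lemma num_digit Q T f i :
    (forall t, t < T -> f t < Q) -> i < T -> (num Q T f %/ Q ^ i) %% Q = f i.
Proof.
elim: T f i => [|T IH] f i fQ // iT.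
have Q0 : 0 < Q by have := fQ 0 isT; lia.
rewrite num_recl [_ + Q * _]addnC; case: i iT => [|i] iT.
  by rewrite divn1 mulnC modnMDl modn_small ?fQ.
rewrite expnS divnMA [Q * num _ _ _]mulnC divnMDl //.
rewrite [f 0 %/ Q]divn_small ?fQ // addn0.
by rewrite IH // => t tT; apply: fQ.
Qed.

Lemma num_digits Q T A :
  A < Q ^ T -> num Q T (fun t => (A %/ Q ^ t) %% Q) = A.
Proof.
elim: T A => [|T IH] A AQ; first by rewrite /num big_ord0; case: A AQ.
have Q0 : 0 < Q by case: (posnP Q) AQ => // ->; rewrite expnS.
rewrite num_recl divn1 mulnC addnC [RHS](divn_eq A Q); congr (_ * _ + _).
rewrite -[RHS]IH; last by rewrite ltn_divLR // -expnSr.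
by apply: eq_num => t _; rewrite expnS divnMA.
Qed.

Lemma num_ones Q T : 1 < Q -> (Q ^ T).-1 %/ Q.-1 = num Q T (fun=> 1).
Proof.
move=> Q1; rewrite predn_exp mulKn; last lia.
by apply: eq_bigr => i _; rewrite mul1n.
Qed.

Definition shift (x : nat) (f : nat -> nat) (t : nat) : nat :=
  if t is t'.+1 then f t' else x.

(** Multiplication by [Q] delays the digit sequence by one time unit, with [x] entering at time 0;
    the digit pushed out at the top is a multiple of [Q ^ T], to be discarded modulo [Q ^ T]. *)
Lemma num_shift Q T x f :
  Q * num Q T f + x = num Q T (shift x f) + shift x f T * Q ^ T.
Proof. by rewrite -num_recr num_recl addnC. Qed.

(** One binary digit of Lucas' theorem modulo 2. Pascal's rule gives by induction that
    ['C(m.*2, l.*2)] has the parity of ['C(m, l)] and that ['C(m.*2, l.*2.+1)] is even. *)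
Lemma odd_bin_bit (a b : bool) n k :
  odd 'C(b + n.*2, a + k.*2) = (a <= b) && odd 'C(n, k).
Proof.
have H m : (forall l, odd 'C(m.*2, l.*2) = odd 'C(m, l)) /\
           (forall l, odd 'C(m.*2, l.*2.+1) = false).
  elim: m => [|m [IHe IHo]].
    by split; case.
  split; case=> [|l].
  - by rewrite !bin0.
  - by rewrite !doubleS !binS !oddD -!doubleS IHe IHo IHe addbF addFb.
  - by rewrite bin1 /= odd_double.
  - by rewrite !doubleS !binS !oddD -!doubleS !IHo addbF addFb addbb.
have [He Ho] := H n.
case: b; case: a; rewrite ?add0n ?add1n /=.
- by rewrite binS oddD He Ho.
- case: k => [|k]; first by rewrite !bin0.
  by rewrite doubleS binS oddD -doubleS He Ho addbF.
- exact: Ho.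
- exact: He.
Qed.

Lemma odd_bin_block e a0 b0 a1 b1 : a0 < 2 ^ e -> b0 < 2 ^ e ->
  odd 'C(b0 + 2 ^ e * b1, a0 + 2 ^ e * a1) = odd 'C(b0, a0) && odd 'C(b1, a1).
Proof.
elim: e a0 b0 => [|e IH] a0 b0.
  by rewrite expn0 !ltnS !leqn0 !mul1n => /eqP-> /eqP->.
rewrite expnS => Ha Hb.
have E x y : x + 2 * 2 ^ e * y = odd x + (x./2 + 2 ^ e * y).*2.
  by rewrite -{1}(odd_double_half x); lia.
have {}Ha : a0./2 < 2 ^ e by move: Ha; rewrite -{1}(odd_double_half a0); lia.
have {}Hb : b0./2 < 2 ^ e by move: Hb; rewrite -{1}(odd_double_half b0); lia.
rewrite !E odd_bin_bit IH //.
by rewrite andbA -odd_bin_bit !odd_double_half.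
Qed.

Lemma odd_bin_num e T f g : let Q := 2 ^ e in
    (forall t, t < T -> f t < Q) -> (forall t, t < T -> g t < Q) ->
  odd 'C(num Q T g, num Q T f) <-> forall t, t < T -> odd 'C(g t, f t).
Proof.
move=> Q; elim: T f g => [|T IH] f g fQ gQ; first by rewrite /num !big_ord0.
rewrite !num_recl odd_bin_block ?fQ ?gQ //.
have /IH {}IH : forall t, t < T -> f t.+1 < Q by move=> t tT; apply: fQ.
have /IH {}IH : forall t, t < T -> g t.+1 < Q by move=> t tT; apply: gQ.
split=> [/andP[o0 /IH oS] [|t] // /oS //|o].
by apply/andP; split; [apply: o | apply/IH => t tT; apply: o].
Qed.

Lemma odd_bin1 d : odd 'C(1, d) = (d <= 1).
Proof. by case: d => [|[|d]]. Qed.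

Lemma odd_bin_ones e d : odd 'C((2 ^ e).-1, d) = (d < 2 ^ e).
Proof.
elim: e d => [|e IH] d; first by case: d.
have -> : (2 ^ e.+1).-1 = true + (2 ^ e).-1.*2.
  by have := expn_gt0 2 e; rewrite expnS; lia.
rewrite -{1}(odd_double_half d) odd_bin_bit IH leq_b1 /= expnS.
by rewrite -{2}(odd_double_half d); lia.
Qed.

(** By the binomial theorem, the base-[X] digits of [X.+1 ^ b] are the coefficients ['C(b, i)]: they
    are at most [2 ^ b < X]. As [X] is even, the quotient has the parity of its lowest digit. *)
Lemma odd_bin_div b a :
  odd (((2 ^ b.+1).+1 ^ b) %/ 2 ^ (b.+1 * a)) = odd 'C(b, a).
Proof.
set X := 2 ^ b.+1.
have X0 : 0 < X by rewrite expn_gt0.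
have E : X.+1 ^ b = num X b.+1 (fun i => 'C(b, i)).
  rewrite -add1n expnDn; apply: eq_bigr => i _.
  by rewrite exp1n mul1n.
have C t : t < b.+1 -> 'C(b, t) < X.
  move=> tb; apply: (@leq_ltn_trans (2 ^ b)); last by rewrite ltn_exp2l.
  have -> : 2 ^ b = \sum_(i < b.+1) 'C(b, i).
    rewrite -[2]/(1 + 1) expnDn; apply: eq_bigr => i _.
    by rewrite !exp1n !muln1.
  by rewrite (bigD1 (Ordinal tb)) //= leq_addr.
rewrite E expnM -/X; case: (ltnP a b.+1) => ab.
  rewrite -(num_digit C ab) [in LHS](divn_eq (_ %/ X ^ a) X) oddD oddM.
  by rewrite [odd X]oddX /= andbF.
rewrite divn_small ?bin_small //.
by apply: leq_trans (num_lt C) _; rewrite leq_pexp2l.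
Qed.

(** * Coding the runs of a register machine *)

Definition weight (c : instr) : nat :=
  match c with Inc r q => r + q | Dec r q q0 => r + q + q0 end.

(** One number above the program size and above every state and register index that occurs in
    [P]. *)
Definition bound (P : program) : nat := (size P + \sum_(c <- P) weight c).+1.

Lemma weight_bound P i c : onth P i = Some c -> weight c < bound P.
Proof.
move=> Pi; rewrite /bound ltnS; apply: leq_trans (leq_addl _ _).
elim: P i Pi => [|c' P IH] [|i] //=; rewrite big_cons.
  by case=> ->; rewrite leq_addr.
by move/IH => h; apply: leq_trans h (leq_addl _ _).
Qed.

(* The machine has two transitions per state [i]: number [i.*2] when the      *)
(* register tested by a [Dec] is nonzero, number [i.*2.+1] when it is zero.   *)
Definition dst (P : program) (k : nat) : nat :=
  match onth P k./2 with
  | Some (Inc _ q) => q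
  | Some (Dec _ q q0) => if odd k then q0 else q
  | None => k./2
  end.

Definition up (P : program) (j k : nat) : bool :=
  if onth P k./2 is Some (Inc r _) then j == r else false.

Definition down (P : program) (j k : nat) : bool :=
  if onth P k./2 is Some (Dec r _ _) then (j == r) && ~~ odd k else false.

(** Says whether transition [k] allows register [j] to be nonzero; only the zero branch of a [Dec]
    on [j] forbids it. *)
Definition free (P : program) (j k : nat) : bool :=
  if onth P k./2 is Some (Dec r _ _) then ~~ ((j == r) && odd k) else true.

Lemma dst_lt P k : k < (bound P).*2 -> dst P k < bound P.
Proof.
rewrite -ltn_half_double /dst => kN.
case Pk: onth => [[r q|r q q0]|] //.
  by have /= := weight_bound Pk; lia.
by have /= := weight_bound Pk; case: ifP; lia.
Qed.

Definition choice (P : program) (c : config) : nat :=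
  nat_of_bool (if onth P c.1 is Some (Dec r _ _) then c.2 r == 0 else false)
  + c.1.*2.

Lemma half_choice P c : (choice P c)./2 = c.1.
Proof. by rewrite /choice half_bit_double. Qed.

Lemma odd_choice P c :
  odd (choice P c) =
  if onth P c.1 is Some (Dec r _ _) then c.2 r == 0 else false.
Proof. by rewrite /choice oddD odd_double addbF oddb. Qed.

Lemma step_choice P c (k := choice P c) j :
  [/\ (step P c).1 = dst P k, c.2 j + up P j k = (step P c).2 j + down P j k
    & free P j k || (c.2 j == 0)].
Proof.
rewrite /dst /up /down /free half_choice odd_choice.
case: c @k => pc R _ /=; case: (onth P pc) => [[r q|r q q0]|] /=; last by [].
- by rewrite /upd; case: eqP => [->|_]; split; lia.
- case Rr: (R r) => [|n] /=; rewrite /upd; case: eqP => [->|_]; split=> //; lia.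
Qed.

(** The register equations force the right branch of a [Dec]: the even transition requires
    [R r = R' r + 1], hence [R r] nonzero, and the odd one requires [R r = 0] through [free]. *)
Lemma step_fires P k R R' c : k < (bound P).*2 -> c.1 = k./2 ->
    (forall j, j < bound P -> c.2 j = R j) ->
    (forall j, j < bound P -> R j + up P j k = R' j + down P j k) ->
    (forall j, j < bound P -> free P j k || (R j == 0)) ->
  (step P c).1 = dst P k /\ forall j, j < bound P -> (step P c).2 j = R' j.
Proof.
rewrite /dst /up /down /free => kN; case: c => pc S /= -> SR.
case Pk: (onth P k./2) => [[r q|r q q0]|] /= upd_R zero_R.
- split=> // j jN; rewrite /upd; move: (upd_R _ jN).
  have /= := weight_bound Pk; move=> rN.
  by rewrite -!SR //; case: eqP => [->|_]; lia.
- have /= rN := weight_bound Pk.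
  have {}rN : r < bound P by lia.
  have {zero_R} := zero_R _ rN; have := upd_R _ rN; rewrite -SR // eqxx /=.
  case: (odd k) upd_R => upd_R /=.
    move=> _ /eqP Sr; rewrite Sr; split=> // j jN.
    by move: (upd_R _ jN); rewrite /= SR // andbF; lia.
  case Sr: (S r) => [|n]; first by lia.
  move=> e _; split=> // j jN; move: (upd_R _ jN).
  by rewrite -SR // /upd /=; case: eqP => [->|_] /=; lia.
- by split=> // j jN; rewrite /= SR //; move: (upd_R _ jN); lia.
Qed.

Definition run (P : program) (x1 x2 t : nat) : config :=
  iter t (step P) (start [:: x1; x2]).

Lemma run_pc P x1 x2 t : (run P x1 x2 t).1 < bound P.
Proof.
elim: t => [|t IH] //; rewrite /run iterS -/(run _ _ _ _).
have [-> _ _] := step_choice P (run P x1 x2 t) 0.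
by apply: dst_lt; rewrite -ltn_half_double half_choice.
Qed.

Lemma run_reg P x1 x2 t j : (run P x1 x2 t).2 j <= x1 + x2 + t.
Proof.
elim: t => [|t IH]; first by case: j => [|[|j]] /=; rewrite ?nth_nil; lia.
have [_ + _] := step_choice P (run P x1 x2 t) j.
rewrite -[step _ _]/(run P x1 x2 t.+1).
by do 2!case: (_ P j _) => /=; lia.
Qed.

(* [kappa t] is the transition taken at time [t] and [r j t] the content of   *)
(* register [j] before it.                                                    *)
Definition trace (P : program) (x1 x2 s q : nat) (kappa : nat -> nat)
    (r : nat -> nat -> nat) : Prop :=
  [/\ forall t, t <= s ->
        kappa t < (bound P).*2 /\ (kappa t)./2 = shift 0 (dst P \o kappa) t,
      forall j, j < bound P -> forall t, t <= s ->
        odd 'C(q.-1 * free P j (kappa t), r j t),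
      forall j, j < bound P -> forall t, t <= s ->
        shift (nth 0 [:: x1; x2] j) (fun t => r j t + up P j (kappa t)) t
        = r j t + shift 0 (fun t => down P j (kappa t) : nat) t
    & size P <= (kappa s)./2 /\ r 0 s = 1].

Lemma odd_bin_bool e (b : bool) d :
  odd 'C((2 ^ e).-1 * b, d) = (d < 2 ^ e) && (b || (d == 0)).
Proof.
case: b; first by rewrite muln1 odd_bin_ones andbT.
by rewrite muln0; case: d => [|d]; rewrite ?expn_gt0 //= andbF.
Qed.

Lemma trace_run P x1 x2 s e kappa r : trace P x1 x2 s (2 ^ e) kappa r ->
  size P <= (run P x1 x2 s).1 /\ (run P x1 x2 s).2 0 = 1.
Proof.
case=> pcs masks regs [fin_pc fin_r].
suff H t : t <= s -> (run P x1 x2 t).1 = (kappa t)./2 /\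
    forall j, j < bound P -> (run P x1 x2 t).2 j = r j t.
  by have [-> ->] := H s (leqnn s).
elim: t => [|t IH] ts.
  split=> [|j jN]; first by have [_ ->] := pcs 0 ts.
  by have /= := regs j jN 0 ts; lia.
have [pc_t r_t] := IH (ltnW ts).
have [kN _] := pcs t (ltnW ts).
have upd_r j : j < bound P ->
    r j t + up P j (kappa t) = r j t.+1 + down P j (kappa t).
  by move=> jN; apply: (regs j jN _ ts).
have zero_r j : j < bound P -> free P j (kappa t) || (r j t == 0).
  by move=> jN; have := masks j jN t (ltnW ts); rewrite odd_bin_bool => /andP[].
have [pc' r'] := step_fires kN pc_t r_t upd_r zero_r.
by rewrite /run iterS -/(run _ _ _ _) pc'; have [_ ->] := pcs _ ts.
Qed.

Lemma run_trace P x1 x2 s e : x1 + x2 + s < 2 ^ e ->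
    size P <= (run P x1 x2 s).1 -> (run P x1 x2 s).2 0 = 1 ->
  trace P x1 x2 s (2 ^ e) (fun t => choice P (run P x1 x2 t))
    (fun j t => (run P x1 x2 t).2 j).
Proof.
move=> lt_e fin_pc fin_r; split=> [t ts|j jN t ts|j jN [|t] ts|].
- rewrite -ltn_half_double half_choice run_pc; split=> //.
  by case: t ts => [|t] _ //=; have [-> _ _] := step_choice P (run P x1 x2 t) 0.
- rewrite odd_bin_bool; have [_ _ ->] := step_choice P (run P x1 x2 t) j.
  by rewrite andbT; have := run_reg P x1 x2 t j; lia.
- by rewrite /= addn0.
- by rewrite /=; have [_ -> _] := step_choice P (run P x1 x2 t) j.
- by rewrite half_choice.
Qed.

(* This exceeds the number of transitions and, since a step increases a       *)
(* register by at most 1, every register up to time [s]; the base             *)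
(* [Q := 2 * q] of [history] leaves room for one more increment.              *)
Definition radix (P : program) (x1 x2 s : nat) : nat :=
  2 ^ (x1 + x2 + s + (bound P).*2).

(* [w] packs in base [M] the indicators [D k] of the transitions and the      *)
(* registers [R j].  Equations hold modulo [M = Q ^ s.+1] because the effect  *)
(* of the transition taken at the last time [s] is dropped.  The mask on      *)
(* [R j] both bounds its digits by [q] and makes them 0 at zero tests.        *)
Definition history (P : program) (x1 x2 s w : nat) : bool :=
  let N := bound P in
  let q := radix P x1 x2 s in
  let Q := 2 * q in
  let M := Q ^ s.+1 in
  let ones := (M - 1) %/ (Q - 1) in
  let D k := (w %/ M ^ k) %% M in
  let R j := (w %/ M ^ (N.*2 + j)) %% M in
  let lin a := \sum_(k < N.*2) a k * D k in
  [&& all (fun k => odd 'C(ones, D k)) (iota 0 N.*2),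
      lin (fun=> 1) == ones,
      (Q * lin (dst P)) %% M == lin half %% M,
      all (fun j => odd 'C((q - 1) * lin (free P j), R j)) (iota 0 N),
      all (fun j => (Q * (R j + lin (up P j)) + nth 0 [:: x1; x2] j) %% M
                    == (R j + Q * lin (down P j)) %% M) (iota 0 N),
      size P <= lin half %/ Q ^ s
    & R 0 %/ Q ^ s == 1].

Lemma all_iotaP n (p : pred nat) :
  reflect (forall i, i < n -> p i) (all p (iota 0 n)).
Proof.
apply: (iffP allP) => H i; first by move=> lt_i; apply: H; rewrite mem_iota.
by rewrite mem_iota => /H.
Qed.

Lemma sum_delta K k0 (a : nat -> nat) : k0 < K ->
  \sum_(k < K) a k * (k == k0 :> nat) = a k0.
Proof.
move=> k0K; rewrite (bigD1 (Ordinal k0K)) //= eqxx muln1 big1 ?addn0 //.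
by move=> i /negPf; rewrite -val_eqE /= => ->; rewrite muln0.
Qed.

Lemma sum_eq1_delta K (d : nat -> nat) :
    (forall k, k < K -> d k <= 1) -> \sum_(k < K) d k = 1 ->
  let k0 := \sum_(k < K) k * d k in
  k0 < K /\ forall k, k < K -> d k = (k == k0).
Proof.
elim: K => [|K IH] d1; first by rewrite big_ord0.
rewrite !big_ord_recr /=; have := d1 K (ltnSn K); case dK: (d K) => [|[|//]] _.
  rewrite addn0 muln0 addn0 => /IH[k|k0K H]; first by move=> kK; apply: d1; lia.
  split; first exact: ltnW.
  move=> k; rewrite ltnS leq_eqVlt => /orP[/eqP->|/H //].
  by rewrite dK gtn_eqF.
rewrite muln1 addn1 => -[] /eqP; rewrite sum_nat_eq0 => /forallP d0.
have {}d0 k : k < K -> d k = 0.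
  by move=> kK; have /eqP := implyP (d0 (Ordinal kK)) isT.
rewrite big1 ?add0n; last by move=> i _; rewrite d0 ?muln0.
split=> // k; rewrite ltnS leq_eqVlt => /orP[/eqP->|kK].
  by rewrite dK eqxx.
by rewrite d0 // ltn_eqF.
Qed.

Lemma double_lt_radix P x1 x2 s : (bound P).*2 < radix P x1 x2 s.
Proof. by apply: leq_ltn_trans (ltn_expl _ (leqnn 2)); rewrite leq_addl. Qed.

Lemma inputs_lt_radix P x1 x2 s : x1 + x2 + s < radix P x1 x2 s.
Proof. by apply: leq_ltn_trans (ltn_expl _ (leqnn 2)); rewrite leq_addr. Qed.

Section Coding.
Variables (P : program) (x1 x2 s w : nat) (kappa : nat -> nat)
  (r : nat -> nat -> nat).
Let N := bound P.
Let q := radix P x1 x2 s.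
Let Q := 2 * q.
Let M := Q ^ s.+1.
Let D k := (w %/ M ^ k) %% M.
Let R j := (w %/ M ^ (N.*2 + j)) %% M.
Hypothesis kappaN : forall t, t <= s -> kappa t < N.*2.
Hypothesis Dk : forall k, k < N.*2 -> D k = num Q s.+1 (fun t => k == kappa t).
Hypothesis Rj : forall j, j < N -> R j = num Q s.+1 (r j).
Hypothesis rq : forall j, j < N -> forall t, t <= s -> r j t < Q.

Let Nq : N.*2 < q := double_lt_radix P x1 x2 s.
Let xq : x1 + x2 + s < q := inputs_lt_radix P x1 x2 s.

Let lin_num (a : nat -> nat) :
  \sum_(k < N.*2) a k * D k = num Q s.+1 (fun t => a (kappa t)).
Proof.
under eq_bigr => k _ do rewrite Dk //.
rewrite (num_sum _ _ _ a (fun k t => k == kappa t)); apply: eq_num => t ts.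
by rewrite sum_delta // kappaN.
Qed.


(** Both numbers have [s.+1] digits below [Q], so they are below [M] and congruence is equality of
    digits; [u * M] and [v * M] absorb what is shifted out. *)
Let num_modP f g u v :
  (forall t, t <= s -> f t < Q) -> (forall t, t <= s -> g t < Q) ->
  (num Q s.+1 f + u * M == num Q s.+1 g + v * M %[mod M])
  <-> forall t, t <= s -> f t = g t.
Proof.
move=> fQ gQ; have lt_num h : (forall t, t <= s -> h t < Q) -> num Q s.+1 h < M.
  by move=> hQ; apply: num_lt.
rewrite ![_ + _ * M]addnC !modnMDl !modn_small ?lt_num //.
by split=> [/eqP e|e]; [apply: num_inj e | apply/eqP/eq_num].
Qed.

Let pcsP :
  (Q * (\sum_(k < N.*2) dst P k * D k)
     == \sum_(k < N.*2) k./2 * D k %[mod M])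
  <-> forall t, t <= s -> (kappa t)./2 = shift 0 (dst P \o kappa) t.
Proof.
rewrite (lin_num half) (lin_num (dst P)) -[Q * _]addn0 num_shift.
rewrite -[X in X == _ %[mod _]]addn0 -[X in _ == X %[mod _]]addn0.
rewrite -[X in _ == _ + X %[mod _]](mul0n M) addn0.
have lt_half t : t <= s -> (kappa t)./2 < Q.
  by move/kappaN => kt; rewrite /Q; lia.
rewrite (num_modP _ 0) //; first by split=> e t ts; rewrite e.
case=> [|t] ts /=; rewrite /Q; first lia.
by have := dst_lt (kappaN (ltnW ts)); rewrite -/N; lia.
Qed.

Let maskP : (forall j, j < N ->
    odd 'C((q - 1) * (\sum_(k < N.*2) free P j k * D k), R j))
  <-> forall j, j < N -> forall t, t <= s ->
        odd 'C(q.-1 * free P j (kappa t), r j t).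
Proof.
have H j : j < N ->
    odd 'C((q - 1) * (\sum_(k < N.*2) free P j k * D k), R j)
    <-> forall t, t <= s -> odd 'C(q.-1 * free P j (kappa t), r j t).
  move=> jN; rewrite Rj // (lin_num (free P j)) numZ subn1 /Q -expnS.
  rewrite odd_bin_num //; last move=> t ts.
    by rewrite expnS -[2 ^ _]/q; apply: rq.
  by rewrite expnS -[2 ^ _]/q; case: free; lia.
by split=> h j jN; apply/H/h.
Qed.

Let regP : (forall j t, j < N -> t <= s -> r j t < q) ->
  (forall j, j < N ->
    Q * (R j + \sum_(k < N.*2) up P j k * D k) + nth 0 [:: x1; x2] j
    == R j + Q * (\sum_(k < N.*2) down P j k * D k) %[mod M])
  <-> forall j, j < N -> forall t, t <= s ->
        shift (nth 0 [:: x1; x2] j) (fun t => r j t + up P j (kappa t)) t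
        = r j t + shift 0 (fun t => down P j (kappa t) : nat) t.
Proof.
move=> lt_rq.
suff H j : j < N ->
    (Q * (R j + \sum_(k < N.*2) up P j k * D k) + nth 0 [:: x1; x2] j
    == R j + Q * (\sum_(k < N.*2) down P j k * D k) %[mod M])
    <-> forall t, t <= s ->
        shift (nth 0 [:: x1; x2] j) (fun t => r j t + up P j (kappa t)) t
        = r j t + shift 0 (fun t => down P j (kappa t) : nat) t.
  by split=> h j jN; apply/H/h.
move=> jN; rewrite Rj // (lin_num (up P j)) (lin_num (down P j)) numD num_shift.
rewrite -[Q * _]addn0 num_shift addnA numD num_modP // => -[|t] ts /=;
  rewrite /Q.
- by case: j {jN} => [|[|j]] /=; rewrite ?nth_nil; lia.
- by have := lt_rq j t jN (ltnW ts); case: up; lia.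
- by have := lt_rq j 0 jN (leq0n s); lia.
- by have := lt_rq j t.+1 jN ts; case: down; lia.
Qed.

(** No carry occurs in any of the sums, so each condition on numbers splits into one condition per
    time. The hypotheses on [D] already contain what the first two conjuncts of [history] assert. *)
Lemma history_traceE : history P x1 x2 s w <-> trace P x1 x2 s q kappa r.
Proof.
rewrite /history -/N -/q -/Q -/M.
have Q1 : 1 < Q by rewrite /Q; lia.
have ones : (M - 1) %/ (Q - 1) = num Q s.+1 (fun=> 1).
  by rewrite !subn1 num_ones.
have fin_pc : (\sum_(k < N.*2) k./2 * D k) %/ Q ^ s = (kappa s)./2.
  rewrite (lin_num half) num_divX // => t ts.
  by have := kappaN ts; rewrite /Q; lia.
have fin_r : R 0 %/ Q ^ s = r 0 s.
  by rewrite Rj // num_divX // => t; apply: rq.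
(* The masks bound the registers by [q], half of the base, so that adding an increment or decrement
   bit causes no carry in [regP]. *)
have r_lt_q : (forall j, j < N -> forall t, t <= s ->
    odd 'C(q.-1 * free P j (kappa t), r j t)) ->
    forall j t, j < N -> t <= s -> r j t < q.
  move=> m j t jN ts; have := m j jN t ts.
  by rewrite /q odd_bin_bool => /andP[].
split.
  case/and5P=> _ _ /pcsP pcs /all_iotaP/maskP masks.
  case/and3P=> /all_iotaP regs fpc fr.
  split=> // [t ts||].
  - by split; [apply: kappaN | apply: pcs].
  - by apply/regP => //; apply: r_lt_q.
  - by rewrite -fin_pc -fin_r; split; last exact/eqP.
case=> pcs masks regs [fpc fr]; apply/and5P; split.
- apply/all_iotaP => k kN; rewrite ones -/(D k) Dk // /Q -expnS odd_bin_num.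
  + by move=> t _; rewrite odd_bin1 leq_b1.
  + move=> t _; rewrite expnS -[2 ^ _]/q -/Q.
    by apply: leq_ltn_trans Q1; apply: leq_b1.
  + by move=> t _; rewrite expnS -[2 ^ _]/q -/Q.
- by rewrite (lin_num (fun=> 1)) ones.
- by apply/pcsP => t ts; have [] := pcs t ts.
- by apply/all_iotaP/maskP.
apply/and3P; split.
- by apply/all_iotaP/regP => //; apply: r_lt_q.
- by rewrite -/(D _) fin_pc.
- by rewrite -/(R 0) fin_r fr.
Qed.
End Coding.

Lemma history_run P x1 x2 s :
  (exists w, history P x1 x2 s w) <->
  size P <= (run P x1 x2 s).1 /\ (run P x1 x2 s).2 0 = 1.
Proof.
set N := bound P; pose q := radix P x1 x2 s.
pose Q := 2 * q; pose M := Q ^ s.+1.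
have Nq : N.*2 < q := double_lt_radix P x1 x2 s.
have xq : x1 + x2 + s < q := inputs_lt_radix P x1 x2 s.
have Q1 : 1 < Q by rewrite /Q; lia.
have M0 : 0 < M by rewrite expn_gt0 ltnW.
split=> [[w hist]|[fpc fr]].
  pose X i := (w %/ M ^ i) %% M.
  pose dig i t := (X i %/ Q ^ t) %% Q.
  have digQ i t : dig i t < Q by rewrite ltn_mod ltnW.
  have Xdig i : X i = num Q s.+1 (dig i) by rewrite num_digits // ltn_mod.
  have ones : (M - 1) %/ (Q - 1) = num Q s.+1 (fun=> 1).
    by rewrite !subn1 num_ones.
  have /and3P[/all_iotaP d_le1 /eqP sum_d _] := hist.
  have {}d_le1 k t : t <= s -> k < N.*2 -> dig k t <= 1.
    move=> ts kN; have := d_le1 k kN.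
    rewrite -/(radix P x1 x2 s) -/q -/Q -/M ones -/(X k) Xdig.
    rewrite /Q -expnS odd_bin_num.
    - by move/(_ t ts); rewrite odd_bin1.
    - by move=> u _; rewrite expnS; apply: digQ.
    - by move=> u _; rewrite expnS; apply: Q1.
  (* At most [N.*2 < Q] digits, each 0 or 1, are added, so there is no carry and equality with
     [ones] means that exactly one transition is taken at each time. *)
  have sum1 t : t <= s -> \sum_(k < N.*2) dig k t = 1.
    move: t; pose sum_dig t := \sum_(k < N.*2) dig k t.
    apply: (@num_inj Q s.+1 sum_dig (fun=> 1)) => //.
      move=> t ts; apply: (@leq_ltn_trans N.*2); last by rewrite /Q; lia.
      rewrite -[leqRHS]card_ord -sum1_card; apply: leq_sum => k _; exact: d_le1.
    rewrite -ones -sum_d.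
    under [RHS]eq_bigr => k _ do
      rewrite -/(radix P x1 x2 s) -/q -/Q -/M -/(X k) Xdig.
    rewrite (num_sum _ _ _ (fun=> 1) dig).
    by apply: eq_num => t _; apply: eq_bigr => k _; rewrite mul1n.
  pose kappa t := \sum_(k < N.*2) k * dig k t.
  have kappaP t : t <= s ->
      kappa t < N.*2 /\ forall k, k < N.*2 -> dig k t = (k == kappa t).
    by move=> ts; apply: sum_eq1_delta (sum1 t ts) => k; apply: d_le1.
  apply: (@trace_run P x1 x2 s _ kappa (fun j => dig (N.*2 + j))).
  apply/(@history_traceE P x1 x2 s w) => //.
  - by move=> t /kappaP[].
  - move=> k kN; rewrite -/(X k) Xdig; apply: eq_num => t ts.
    by have [_ ->] := kappaP t ts.
  - by move=> j _; rewrite -(Xdig (N.*2 + j)).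
pose kappa t := choice P (run P x1 x2 t).
pose r j t := (run P x1 x2 t).2 j.
have tr : trace P x1 x2 s q kappa r.
  by apply: run_trace => //; rewrite -/(radix P x1 x2 s).
(* The base-[M] digits of the witness: [N.*2] transition indicators, then [N] registers. *)
pose x i := num Q s.+1
  (if i < N.*2 then fun t => i == kappa t : nat else r (i - N.*2)).
have r_lt j t : t <= s -> r j t < Q.
  by have := run_reg P x1 x2 t j; rewrite /r /Q; lia.
have xM i : x i < M.
  apply: num_lt => t ts; case: ifP => _; last exact: r_lt.
  by apply: leq_ltn_trans Q1; apply: leq_b1.
have digit i : i < N.*2 + N -> (num M (N.*2 + N) x %/ M ^ i) %% M = x i.
  by apply: num_digit.
exists (num M (N.*2 + N) x); apply/history_traceE/tr.
- by move=> t ts; have [] := tr => /(_ t ts)[].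
- by move=> k kN; rewrite digit ?ltn_addr // /x kN.
- by move=> j jN; rewrite digit ?ltn_add2l // /x ltnNge leq_addr /= addKn.
- by move=> j jN t; apply: r_lt.
Qed.

Lemma outputs1E P x1 x2 :
  outputs P [:: x1; x2] 1 <-> exists s w, history P x1 x2 s w.
Proof. by split=> -[s] /history_run h; exists s. Qed.

Lemma outputs_uniq P input y y' :
  outputs P input y -> outputs P input y' -> y = y'.
Proof.
have halted c k : size P <= c.1 -> iter k (step P) c = c.
  move=> hc; elim: k => //= k ->; case: c hc => pc R /= hc.
  by rewrite onth_default.
move=> [k [hk <-]] [k' [hk' <-]]; congr (_.2 0).
by case: (leqP k k') => [|/ltnW] /subnK <-;
  rewrite iterD [iter (_ - _) _ _]halted.
Qed.

(** * Integer square root and unpairing *)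

Section Pell.
Variable n : nat.
Let m := n.+1.

(* [(m + sqrt n) ^ k = (pell k).1 + (pell k).2 * sqrt n] *)
Fixpoint pell (k : nat) : nat * nat :=
  if k is k'.+1 then
    (m * (pell k').1 + n * (pell k').2, (pell k').1 + m * (pell k').2)
  else (1, 0).

(** Multiplicativity of the norm [a ^ 2 - n * b ^ 2], applied to the powers of [m + sqrt n]. *)
Lemma pell_norm k : (pell k).1 ^ 2 = n * (pell k).2 ^ 2 + (m ^ 2 - n) ^ k.
Proof.
elim: k => [|k IH] //=; first by rewrite muln0.
have nm : n <= m ^ 2 by rewrite /m; nia.
rewrite [_ ^ k.+1]expnS.
set a := (pell k).1 in IH *; set b := (pell k).2 in IH *.
move: (subnK nm) IH; move: (m ^ 2 - n) => z; move: (z ^ k) => D me IH.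
have h1 : m ^ 2 * a ^ 2 = (z + n) * a ^ 2 by rewrite me.
have h2 : m ^ 2 * (n * b ^ 2) = (z + n) * (n * b ^ 2) by rewrite me.
have h3 : z * a ^ 2 = z * (n * b ^ 2 + D) by rewrite IH.
move: h1 h2 h3; clear; rewrite -!mulnn; move: m => c; lia.
Qed.

Lemma pell_upper k : (pell k).1 + (pell k).2 <= (2 * m) ^ k.
Proof. by elim: k => [|k IH] //=; rewrite expnS /m in IH *; nia. Qed.

Lemma pell_lower k : m ^ k <= (pell k).1 /\ k * m ^ k <= m * (pell k).2.
Proof.
elim: k => [|k [IHa IHb]] //=; rewrite expnS; split; first nia.
have -> : k.+1 * (m * m ^ k) = m * (m ^ k + k * m ^ k) by lia.
rewrite leq_pmul2l //; lia.
Qed.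

(* Modulo [X ^ 2 - n], [X] is a square root of [n]. *)
Lemma pell_modn X k : (pell k).1 + (pell k).2 * X < X ^ 2 - n ->
  (X + m) ^ k %% (X ^ 2 - n) = (pell k).1 + (pell k).2 * X.
Proof.
move=> lt; rewrite -[RHS](modn_small lt).
have [d X2] : exists d, X ^ 2 = n + d by exists (X ^ 2 - n); lia.
rewrite X2 addKn {lt}.
suff [u ->] : exists u, (X + m) ^ k = u * d + ((pell k).1 + (pell k).2 * X).
  by rewrite modnMDl.
elim: k => [|k [u IH]]; first by exists 0.
exists ((pell k).2 + u * (X + m)); rewrite expnS IH /=.
move: ((pell k).1) ((pell k).2) => a b; nia.
Qed.

(* [(pell k).1 / (pell k).2] tends to [sqrt n] from above. *)
Lemma pell_div r k : m < k -> r ^ 2 <= n -> n < r.+1 ^ 2 ->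
  (pell k).1 %/ (pell k).2 = r.
Proof.
move=> mk rn nr; have [_ lo] := pell_lower k; have norm := pell_norm k.
have b_gt : m ^ k < (pell k).2.
  by have : 0 < m ^ k by [rewrite expn_gt0]; rewrite /m in lo mk *; nia.
(* The error term of the norm equation is below [b ^ 2], so [n * b ^ 2 <= a ^ 2 < n.+1 * b ^ 2],
   which locates [a %/ b] between [r] and [r.+1]. *)
have D_lt : (m ^ 2 - n) ^ k < (pell k).2 ^ 2.
  apply: (@leq_ltn_trans ((m ^ k) ^ 2)); last by rewrite ltn_exp2r.
  by rewrite -expnM mulnC expnM leq_exp2r ?leq_subr //; lia.
move: b_gt D_lt norm; set a := (pell k).1; set b := (pell k).2.
set D := _ ^ k => b_gt D_lt norm; have b0 : 0 < b by apply: leq_ltn_trans b_gt.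
apply/eqP; rewrite eqn_leq leq_divRL // -ltnS ltn_divLR //.
rewrite -(ltn_exp2r a _ (isT : 0 < 2)) -(leq_exp2r _ a (isT : 0 < 2)).
rewrite !expnMn norm.
by apply/andP; split; nia.
Qed.
End Pell.

(** The exponent [m.+1] is large enough for [pell_div]. By [pell_upper], [X] exceeds both components
    of [pell n m.+1], so these are the two base-[X] digits of [V]. *)
Definition isqrt (n : nat) : nat :=
  let m := n.+1 in
  let X := (2 * m) ^ m.+1 + m in
  let V := (X + m) ^ m.+1 %% (X ^ 2 - n) in
  (V %% X) %/ (V %/ X).

Lemma isqrtE n r : r ^ 2 <= n -> n < r.+1 ^ 2 -> isqrt n = r.
Proof.
move=> rn nr; rewrite /isqrt; cbv zeta; set m := n.+1; set X := _ ^ m.+1 + m.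
have := pell_upper n m.+1; rewrite -/m => up.
have X0 : 0 < X by rewrite /X /m; lia.
have aX : (pell n m.+1).1 < X by rewrite /X; lia.
have lt : (pell n m.+1).1 + (pell n m.+1).2 * X < X ^ 2 - n.
  move: up aX; rewrite /X; move: ((pell n m.+1).1) ((pell n m.+1).2) => a b.
  move: ((2 * m) ^ m.+1) => B; rewrite /m; nia.
rewrite pell_modn // [_ + _ * X]addnC modnMDl divnMDl // modn_small //.
by rewrite [_ %/ X]divn_small // addn0; apply: pell_div.
Qed.

(* For [n = r ^ 2 + a] with [a <= r], the pair is [(a, r - a)]. *)
Definition unpair1 (n : nat) : nat := n - isqrt n ^ 2.
Definition unpair2 (n : nat) : nat := isqrt n - unpair1 n.

Lemma unpair_surj a b : exists n, unpair1 n = a /\ unpair2 n = b.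
Proof.
exists ((a + b) ^ 2 + a); rewrite /unpair2 /unpair1 (@isqrtE _ (a + b)); nia.
Qed.

(** * Arithmetic terms *)

Declare Scope aterm_scope.
Delimit Scope aterm_scope with T.
Bind Scope aterm_scope with aterm.
Local Notation "n %:C" := (Const _ n)
  (at level 2, format "n %:C") : aterm_scope.
Local Infix "+" := Add : aterm_scope.
Local Infix "-" := Defs.Sub : aterm_scope.
Local Infix "*" := Mul : aterm_scope.
Local Infix "%/" := Div : aterm_scope.
Local Infix "%%" := Mod : aterm_scope.
Local Infix "^" := Exp : aterm_scope.

Section Terms.
Variable V : Type.
Implicit Types (a b t : aterm V) (rho : V -> nat).

(** The exponent is the distance of [a] and [b]; the test rests on [0 ^ 0 = 1]. *)
Definition eqT a b : aterm V := (0%:C ^ ((a - b) + (b - a)))%T.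
Definition leT a b : aterm V := (1%:C - (a - b))%T.
Definition maskT a b : aterm V :=
  ((((2%:C ^ (b + 1%:C)) + 1%:C) ^ b %/ 2%:C ^ ((b + 1%:C) * a)) %% 2%:C)%T.

Fixpoint sumT (F : nat -> aterm V) (n : nat) : aterm V :=
  if n is n'.+1 then (sumT F n' + F n')%T else 0%:C%T.

Fixpoint allT (F : nat -> aterm V) (n : nat) : aterm V :=
  if n is n'.+1 then (allT F n' * F n')%T else 1%:C%T.

Lemma eval_eqT rho a b : eval rho (eqT a b) = (eval rho a == eval rho b).
Proof.
rewrite eqn_leq -!subn_eq0 -addn_eq0 /=.
by case: (_ + _) => [|k] //; rewrite exp0n.
Qed.

Lemma eval_leT rho a b : eval rho (leT a b) = (eval rho a <= eval rho b).
Proof. by rewrite -subn_eq0 /=; case: (eval rho a - _). Qed.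

Lemma eval_maskT rho a b :
  eval rho (maskT a b) = odd 'C(eval rho b, eval rho a).
Proof. by rewrite /= modn2 !addn1 odd_bin_div. Qed.

Lemma eval_sumT rho F n : eval rho (sumT F n) = \sum_(i < n) eval rho (F i).
Proof. by elim: n => [|n IH]; rewrite ?big_ord0 // big_ord_recr -IH. Qed.

Lemma eval_andT rho a b (p q : bool) :
  eval rho a = p -> eval rho b = q -> eval rho (a * b)%T = p && q.
Proof. by move=> /= -> ->; rewrite mulnb. Qed.

Lemma eval_allT rho F (p : pred nat) n : (forall i, eval rho (F i) = p i) ->
  eval rho (allT F n) = all p (iota 0 n).
Proof.
move=> Fp; elim: n => // n IH.
by rewrite -[in RHS]addn1 iotaD all_cat /= IH Fp andbT mulnb.
Qed.

Definition isqrtT t : aterm V :=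
  let m := (t + 1%:C)%T in
  let X := ((2%:C * m) ^ (m + 1%:C) + m)%T in
  let W := ((X + m) ^ (m + 1%:C) %% (X ^ 2%:C - t))%T in
  ((W %% X) %/ (W %/ X))%T.

Definition unpair1T t : aterm V := (t - isqrtT t ^ 2%:C)%T.
Definition unpair2T t : aterm V := (isqrtT t - unpair1T t)%T.

Lemma eval_unpair1T rho t : eval rho (unpair1T t) = unpair1 (eval rho t).
Proof. by rewrite /= !addn1. Qed.

Lemma eval_unpair2T rho t : eval rho (unpair2T t) = unpair2 (eval rho t).
Proof. by rewrite /= !addn1. Qed.

Definition cpairT a b : aterm V :=
  (((a + b + 1%:C) * (a + b)) %/ 2%:C + b)%T.

Lemma eval_cpairT rho a b :
  eval rho (cpairT a b) = cpair (eval rho a) (eval rho b).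
Proof. by rewrite /= /cpair bin2 /= divn2 addn1. Qed.

Definition historyT (P : program) (x1 x2 s w : aterm V) : aterm V :=
  let N := bound P in
  let q := (2%:C ^ (x1 + x2 + s + N.*2%:C))%T in
  let Q := (2%:C * q)%T in
  let M := (Q ^ (s + 1%:C))%T in
  let ones := ((M - 1%:C) %/ (Q - 1%:C))%T in
  let D k := ((w %/ M ^ k%:C) %% M)%T in
  let R j := ((w %/ M ^ (N.*2 + j)%N%:C) %% M)%T in
  let lin c := sumT (fun k => (c k)%:C * D k)%T N.*2 in
  (allT (fun k => maskT (D k) ones) N.*2 *
   (eqT (lin (fun=> 1)) ones *
    (eqT ((Q * lin (dst P)) %% M) (lin half %% M) *
     (allT (fun j => maskT (R j) ((q - 1%:C) * lin (free P j))) N *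
      (allT (fun j =>
         eqT ((Q * (R j + lin (up P j)) + nth 0%:C [:: x1; x2] j) %% M)
             ((R j + Q * lin (down P j)) %% M)) N *
       (leT (size P)%:C (lin half %/ Q ^ s) *
        eqT (R 0 %/ Q ^ s) 1%:C))))))%T.

Lemma eval_historyT rho P x1 x2 s w :
  eval rho (historyT P x1 x2 s w)
  = history P (eval rho x1) (eval rho x2) (eval rho s) (eval rho w).
Proof.
rewrite /historyT /history /radix; cbv zeta.
move: (bound P) => N; set q := (_ ^ (x1 + x2 + s + _))%T.
set Q := (_ * q)%T; set M := (Q ^ (s + _))%T.
pose D k := Mod (Div w (Exp M (Const V k))) M.
have eM : eval rho M = (2 * 2 ^ (eval rho x1 + eval rho x2 + eval rho s + N.*2))
    ^ (eval rho s).+1 by rewrite /= addn1.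
have elin (c : nat -> nat) :
    eval rho (sumT (fun k => Mul (Const V (c k)) (D k)) N.*2) =
    \sum_(k < N.*2) c k * eval rho (D k) by rewrite eval_sumT.
have einit j :
    eval rho (nth (Const V 0) [:: x1; x2] j) =
    nth 0 [:: eval rho x1; eval rho x2] j.
  by case: j => [|[|j]] //=; rewrite !nth_nil.
rewrite -eM; do ![apply: eval_andT].
- by apply: eval_allT => k; rewrite eval_maskT.
- by rewrite eval_eqT elin.
- by rewrite eval_eqT /= !elin.
- by apply: eval_allT => j; rewrite eval_maskT /= elin.
- by apply: eval_allT => j; rewrite eval_eqT /= !elin einit.
- by rewrite eval_leT /= elin.
- by rewrite eval_eqT.
Qed.

End Terms.

(** * Self-reference and the diagonal argument *)

Definition guard (z t : uterm) : uterm := (eqT z (godel t)%:C * t)%T.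

Lemma ueval_guard z t n :
  ueval (guard z t) n = (ueval z n == godel t) * ueval t n.
Proof.
by rewrite /ueval -[godel t]/(eval (fun=> n) (Const unit (godel t))) -eval_eqT.
Qed.

(* This depends on [t] through [godel t = c] only. *)
Definition godel_guardT (z c : uterm) : uterm :=
  let g := (godel z)%:C%T in
  let d := cpairT 1%:C c in
  cpairT 4%:C (cpairT (cpairT 7%:C (cpairT (cpair 1 0)%:C (cpairT 2%:C
    (cpairT (cpairT 3%:C (cpairT g d)) (cpairT 3%:C (cpairT d g)))))) c).

(** Holds by computation: [t] enters the code of [guard z t] as a subterm, with code [godel t], and
    as the constant [godel t], with code [cpair 1 (godel t)]. *)
Lemma eval_godel_guardT z c t n :
  ueval c n = godel t -> ueval (godel_guardT z c) n = godel (guard z t).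
Proof. by rewrite /ueval /godel_guardT => ct; rewrite !eval_cpairT ct. Qed.

Theorem corollary1 :
  ~ exists P : program,
      decides P (fun t1 t2 : uterm => forall n : nat, ueval t1 n = ueval t2 n).
Proof.
case=> P decP.
pose u : uterm := Var tt.
have [z [s [w zsw]]] : exists z s w : uterm, forall a b c,
    exists n, [/\ ueval z n = a, ueval s n = b & ueval w n = c].
  exists (unpair1T u), (unpair1T (unpair2T u)), (unpair2T (unpair2T u)).
  move=> a b c.
  have [m [m1 m2]] := unpair_surj b c; have [n [n1 n2]] := unpair_surj a m.
  by exists n; rewrite /ueval !(eval_unpair1T, eval_unpair2T) n2.
pose zero : uterm := Const _ 0.
(* The second [z] stands for the unknown code of [t], which does not exist yet; the guard will
   restrict attention to those [n] where the guess is right. *)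
pose t := historyT P (godel_guardT z z) (Const _ (godel zero)) s w.
have [dec1 dec0] := decP (guard z t) zero.
have evalt n : ueval z n = godel t ->
    ueval t n = history P (godel (guard z t)) (godel zero)
                  (ueval s n) (ueval w n).
  move=> zt; rewrite /ueval eval_historyT -!/(ueval _ n).
  by rewrite (eval_godel_guardT _ zt).
(* If the guarded term vanished identically, [P] would answer 1; an [n] that codes this run together
   with [godel t] would give it the value 1. *)
have no : ~ forall n, ueval (guard z t) n = ueval zero n.
  move=> t0; have /outputs1E[b [c hist]] := dec1 t0.
  have [n [zn sn wn]] := zsw (godel t) b c.
  by have := t0 n; rewrite ueval_guard evalt // zn eqxx sn wn hist.
(* Now [P] answers 0, so by uniqueness of the output no run answers 1, and the guarded term vanishes
   identically after all. *)
apply: (no) => n; rewrite ueval_guard; case: eqP => // /evalt ->.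
case hist: (history _ _ _ _ _) => //.
have out1 : outputs P [:: godel (guard z t); godel zero] 1.
  by apply/outputs1E; exists (ueval s n), (ueval w n).
by have := outputs_uniq out1 (dec0 no).
Qed.
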